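(* Let $\mathbf{\Omega}$ be a chain and let $\overline{\mathbf{\Omega}}$ be its integral extension. Then the assignment $f\mapsto\overline{f}$ is an $\ell$-pregroup embedding of $\mathbf{F}(\mathbf{\Omega})$ into $\mathbf{F}(\overline{\mathbf{\Omega}})$.
   Context: For a map $f$ on a chain, $f^{r}$ denotes its residual ($f(a)\le b\iff a\le f^r(b)$) and $f^{\ell}$ its dual residual ($f^{\ell}(a)\le b\iff a\le f(b)$), when they exist. For a chain $\mathbf{\Omega}$, $F(\mathbf{\Omega})$ is the set of order-preserving maps on $\Omega$ with residuals of all orders and dual residuals of all orders; $\mathbf{F}(\mathbf{\Omega})$ is the $\ell$-pregroup on $F(\mathbf{\Omega})$ with composition, identity map, pointwise lattice order, and $f\mapsto f^{\ell}$, $f\mapsto f^{r}$. Let $\Omega^{-}=\{a\in\Omega: a=\bigvee_{b<a}b\}$ and $\Omega^{+}=\{a\in\Omega: a=\bigwedge_{a<b}b\}$. The chain $\overline{\mathbf{\Omega}}$ has underlying set $\Omega\cup\{(k,a):a\in\Omega^{+},k\in\mathbb{Z}^{+}\}\cup\{(-k,a):a\in\Omega^{-},k\in\mathbb{Z}^{+}\}$, where each $a\in\Omega$ is identified with $(0,a)$; writing $ka$ for $(k,a)$, the order is $ka\leq nb$ iff $a<b$ or ($a=b$ and $k\leq n$). For $f\in F(\mathbf{\Omega})$ and $kb\in\overline{\Omega}$ define $\overline{f}(kb)=f(b)$ if $|f^{-1}[f(b)]|>1$ or $k=0$, and $\overline{f}(kb)=k\,f(b)$ (i.e., $(k,f(b))$)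 if $|f^{-1}[f(b)]|=1$ and $k\neq 0$. *)

(* Defs.v *)
From HB Require Import structures.
From mathcomp Require Import all_boot all_order all_algebra.
From mathcomp Require Import boolp classical_sets.

Set Implicit Arguments.
Unset Strict Implicit.
Unset Printing Implicit Defensive.

Import Order.TTheory.
Local Open Scope classical_set_scope.
Local Open Scope order_scope.

(* [ladj] and [radj] are the operations written x^l and x^r. *)
HB.mixin Record isLPregroup d T of Order.Lattice d T & Monoid T := {
  ladj : T -> T;
  radj : T -> T;
  lpmul_le : forall x y z w : T,
    x <= y -> z <= w -> (x * z)%g <= (y * w)%g;
  ladj_mul_le1 : forall x : T, (ladj x * x)%g <= (1%g : T);
  mul_ladj_ge1 : forall x : T, (1%g : T) <= (x * ladj x)%g;
  mul_radj_le1 : forall x : T, (x * radj x)%g <= (1%g : T);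
  radj_mul_ge1 : forall x : T, (1%g : T) <= (radj x * x)%g
}.

#[short(type="lpregroupType")]
HB.structure Definition LPregroup d :=
  { T of isLPregroup d T & Order.Lattice d T & Monoid T }.

Definition lpregroup_morphism d d' (A : lpregroupType d) (B : lpregroupType d')
    (phi : A -> B) : Prop :=
  [/\ monoid_morphism phi,
      {morph phi : x y / x `&` y}, {morph phi : x y / x `|` y},
      {morph phi : x / ladj x} & {morph phi : x / radj x}].

Definition lpregroup_embedding d d' (A : lpregroupType d)
    (B : lpregroupType d') (phi : A -> B) : Prop :=
  injective phi /\ lpregroup_morphism phi.

Section Residuals.
Context {d : Order.disp_t} {T : orderType d}.
Implicit Types f g h : T -> T.

(* [residual f g] says that g is the residual of f, and equivalently that f is
   the dual residual of g. *)
Definition residual f g : Prop := forall a b, (f a <= b) = (a <= g b).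

Fixpoint has_residuals n f : Prop :=
  if n is m.+1 then exists2 g, residual f g & has_residuals m g else True.

Fixpoint has_dual_residuals n f : Prop :=
  if n is m.+1 then exists2 g, residual g f & has_dual_residuals m g else True.

Lemma residual_uniqr f g h : residual f g -> residual f h -> g = h.
Proof.
move=> fg fh; apply/funext => b; apply/le_anti.
by rewrite -fh fg lexx -fg fh lexx.
Qed.

Lemma residual_uniql f g h : residual g f -> residual h f -> g = h.
Proof.
move=> gf hf; apply/funext => b; apply/le_anti.
by rewrite gf -hf lexx hf -gf lexx.
Qed.

Lemma residual_homo f g : residual f g -> {homo f : x y / x <= y}.
Proof. by move=> fg x y xy; rewrite fg (le_trans xy)// -fg. Qed.

Lemma residual_homor f g : residual f g -> {homo g : x y / x <= y}.
Proof. by move=> fg x y xy; rewrite -fg (le_trans _ xy)// fg. Qed.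

Lemma residual_id : residual id id.
Proof. by []. Qed.

Lemma residual_comp f f' g g' :
  residual f f' -> residual g g' -> residual (f \o g) (g' \o f').
Proof. by move=> ff gg a b /=; rewrite ff gg. Qed.

Lemma residual_meet f f' g g' : residual f f' -> residual g g' ->
  residual (fun x => f x `&` g x) (fun x => f' x `|` g' x).
Proof. by move=> ff gg a b; rewrite leIx lexU ff gg. Qed.

Lemma residual_join f f' g g' : residual f f' -> residual g g' ->
  residual (fun x => f x `|` g x) (fun x => f' x `&` g' x).
Proof. by move=> ff gg a b; rewrite leUx lexI ff gg. Qed.

Record resmap := Resmap {
  resmap_fun :> T -> T;
  resmap_homo : {homo resmap_fun : x y / x <= y};
  resmap_res : forall n, has_residuals n resmap_fun;
  resmap_dres : forall n, has_dual_residuals n resmap_fun }.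

HB.instance Definition _ := gen_eqMixin resmap.
HB.instance Definition _ := gen_choiceMixin resmap.

Lemma resmapP (f g : resmap) : f =1 g -> f = g.
Proof.
case: f g => [f f1 f2 f3] [g g1 g2 g3] /= /funext fg; subst g.
by congr Resmap; apply: Prop_irrelevance.
Qed.

Lemma resmap_ex_res (f : resmap) : exists g, residual f g.
Proof. by have [g fg _] := resmap_res f 1; exists g. Qed.

Lemma resmap_ex_dres (f : resmap) : exists g, residual g f.
Proof. by have [g fg _] := resmap_dres f 1; exists g. Qed.

Definition res_fun (f : resmap) : T -> T := sval (cid (resmap_ex_res f)).
Definition dres_fun (f : resmap) : T -> T := sval (cid (resmap_ex_dres f)).

Lemma res_funP (f : resmap) : residual f (res_fun f).
Proof. exact: svalP (cid (resmap_ex_res f)). Qed.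

Lemma dres_funP (f : resmap) : residual (dres_fun f) f.
Proof. exact: svalP (cid (resmap_ex_dres f)). Qed.

Fact res_fun_res (f : resmap) n : has_residuals n (res_fun f).
Proof.
have [g fg] := resmap_res f n.+1.
by rewrite (residual_uniqr (res_funP f) fg).
Qed.

Fact res_fun_dres (f : resmap) n : has_dual_residuals n (res_fun f).
Proof.
case: n => //= n; exists f; [exact: res_funP|exact: resmap_dres].
Qed.

Fact dres_fun_res (f : resmap) n : has_residuals n (dres_fun f).
Proof.
case: n => //= n; exists f; [exact: dres_funP|exact: resmap_res].
Qed.

Fact dres_fun_dres (f : resmap) n : has_dual_residuals n (dres_fun f).
Proof.
have [g fg] := resmap_dres f n.+1.
by rewrite (residual_uniql (dres_funP f) fg).
Qed.

Definition resmap_radj (f : resmap) : resmap :=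
  Resmap (residual_homor (res_funP f)) (res_fun_res f) (res_fun_dres f).

Definition resmap_ladj (f : resmap) : resmap :=
  Resmap (residual_homo (dres_funP f)) (dres_fun_res f) (dres_fun_dres f).

Fact id_res n : has_residuals n id.
Proof. by elim: n => //= n IHn; exists id. Qed.

Fact id_dres n : has_dual_residuals n id.
Proof. by elim: n => //= n IHn; exists id. Qed.

Definition resmap_id : resmap := @Resmap id (fun x y => id) id_res id_dres.

Fact comp_homo (f g : resmap) : {homo f \o g : x y / x <= y}.
Proof. by move=> x y xy /=; do 2!apply: resmap_homo. Qed.

Fact comp_res n f g :
  has_residuals n f -> has_residuals n g -> has_residuals n (f \o g).
Proof.
elim: n f g => //= n IHn f g [f' ff nf] [g' gg ng].
by exists (g' \o f'); [exact: residual_comp|exact: IHn].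
Qed.

Fact comp_dres n f g : has_dual_residuals n f -> has_dual_residuals n g ->
  has_dual_residuals n (f \o g).
Proof.
elim: n f g => //= n IHn f g [f' ff nf] [g' gg ng].
by exists (g' \o f'); [exact: residual_comp|exact: IHn].
Qed.

Definition resmap_comp (f g : resmap) : resmap :=
  Resmap (@comp_homo f g)
    (fun n => comp_res (resmap_res f n) (resmap_res g n))
    (fun n => comp_dres (resmap_dres f n) (resmap_dres g n)).

Fact lattice_res n f g : has_residuals n f -> has_residuals n g ->
  has_residuals n (fun x => f x `&` g x) /\
  has_residuals n (fun x => f x `|` g x).
Proof.
elim: n f g => //= n IHn f g [f' ff nf] [g' gg ng].
have [mI mU] := IHn _ _ nf ng; split.
  by exists (fun x => f' x `|` g' x) => //; exact: residual_meet.
by exists (fun x => f' x `&` g' x) => //; exact: residual_join.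
Qed.

Fact lattice_dres n f g : has_dual_residuals n f -> has_dual_residuals n g ->
  has_dual_residuals n (fun x => f x `&` g x) /\
  has_dual_residuals n (fun x => f x `|` g x).
Proof.
elim: n f g => //= n IHn f g [f' ff nf] [g' gg ng].
have [mI mU] := IHn _ _ nf ng; split.
  by exists (fun x => f' x `|` g' x) => //; exact: residual_join.
by exists (fun x => f' x `&` g' x) => //; exact: residual_meet.
Qed.

Fact meet_homo (f g : resmap) : {homo (fun x => f x `&` g x) : x y / x <= y}.
Proof. by move=> x y xy; apply: leI2; apply: resmap_homo. Qed.

Fact join_homo (f g : resmap) : {homo (fun x => f x `|` g x) : x y / x <= y}.
Proof. by move=> x y xy; apply: leU2; apply: resmap_homo. Qed.

Definition resmap_meet (f g : resmap) : resmap :=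
  Resmap (@meet_homo f g)
    (fun n => (lattice_res (resmap_res f n) (resmap_res g n)).1)
    (fun n => (lattice_dres (resmap_dres f n) (resmap_dres g n)).1).

Definition resmap_join (f g : resmap) : resmap :=
  Resmap (@join_homo f g)
    (fun n => (lattice_res (resmap_res f n) (resmap_res g n)).2)
    (fun n => (lattice_dres (resmap_dres f n) (resmap_dres g n)).2).

Definition resmap_le (f g : resmap) : bool := `[< forall x, f x <= g x >].

Fact resmap_le_refl : reflexive resmap_le.
Proof. by move=> f; apply/asboolP. Qed.

Fact resmap_le_anti : antisymmetric resmap_le.
Proof.
move=> f g /andP[/asboolP fg /asboolP gf]; apply: resmapP => x.
by apply/le_anti; rewrite fg gf.
Qed.

Fact resmap_le_trans : transitive resmap_le.
Proof.
move=> g f h /asboolP fg /asboolP gh; apply/asboolP => x.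
exact: le_trans (fg x) (gh x).
Qed.

End Residuals.
Arguments resmap {d} T.

Fact resmap_display (d : Order.disp_t) : Order.disp_t.
Proof. exact: d. Qed.

HB.instance Definition _ d (T : orderType d) :=
  Order.Le_isPOrder.Build (resmap_display d) (resmap T)
    (@resmap_le_refl d T) (@resmap_le_anti d T) (@resmap_le_trans d T).

Section ResmapLPregroup.
Context {d : Order.disp_t} {T : orderType d}.
Implicit Types f g h : resmap T.

Lemma resmap_leP f g : reflect (forall x, f x <= g x) (f <= g).
Proof. exact: asboolP. Qed.

Fact resmap_lexI f g h : (f <= resmap_meet g h) = (f <= g) && (f <= h).
Proof.
apply/resmap_leP/andP => [fgh|[/resmap_leP fg /resmap_leP fh] x].
  by split; apply/resmap_leP => x; have := fgh x; rewrite lexI => /andP[].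
by rewrite lexI fg fh.
Qed.

Fact resmap_leUx f g h : (resmap_join f g <= h) = (f <= h) && (g <= h).
Proof.
apply/resmap_leP/andP => [fgh|[/resmap_leP fh /resmap_leP gh] x].
  by split; apply/resmap_leP => x; have := fgh x; rewrite leUx => /andP[].
by rewrite leUx fh gh.
Qed.

End ResmapLPregroup.

HB.instance Definition _ d (T : orderType d) :=
  Order.POrder_MeetJoin_isLattice.Build (resmap_display d) (resmap T)
    (@resmap_lexI d T) (@resmap_leUx d T).

Section ResmapMonoid.
Context {d : Order.disp_t} {T : orderType d}.

Fact resmap_compA : associative (@resmap_comp d T).
Proof. by move=> f g h; apply: resmapP. Qed.

Fact resmap_comp1f : left_id resmap_id (@resmap_comp d T).
Proof. by move=> f; apply: resmapP. Qed.

Fact resmap_compf1 : right_id resmap_id (@resmap_comp d T).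
Proof. by move=> f; apply: resmapP. Qed.

End ResmapMonoid.

HB.instance Definition _ d (T : orderType d) :=
  isMonoid.Build (resmap T)
    (@resmap_compA d T) (@resmap_comp1f d T) (@resmap_compf1 d T).

Section ResmapAdjoints.
Context {d : Order.disp_t} {T : orderType d}.
Implicit Types f g h : resmap T.

Fact resmap_mul_le f g h k : f <= g -> h <= k -> (f * h)%g <= (g * k)%g.
Proof.
move=> /resmap_leP fg /resmap_leP hk; apply/resmap_leP => x.
exact: le_trans (fg _) (resmap_homo _ (hk x)).
Qed.

Fact resmap_ladj_mul_le1 f : (resmap_ladj f * f)%g <= 1%g.
Proof. by apply/resmap_leP => x; rewrite /= dres_funP. Qed.

Fact resmap_mul_ladj_ge1 f : (1%g : resmap T) <= (f * resmap_ladj f)%g.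
Proof. by apply/resmap_leP => x; rewrite /= -dres_funP. Qed.

Fact resmap_mul_radj_le1 f : (f * resmap_radj f)%g <= 1%g.
Proof. by apply/resmap_leP => x; rewrite /= res_funP. Qed.

Fact resmap_radj_mul_ge1 f : (1%g : resmap T) <= (resmap_radj f * f)%g.
Proof. by apply/resmap_leP => x; rewrite /= -res_funP. Qed.

End ResmapAdjoints.

HB.instance Definition _ d (T : orderType d) :=
  isLPregroup.Build (resmap_display d) (resmap T)
    (@resmap_mul_le d T) (@resmap_ladj_mul_le1 d T) (@resmap_mul_ladj_ge1 d T)
    (@resmap_mul_radj_le1 d T) (@resmap_radj_mul_ge1 d T).

Section IntegralExtension.
Context {d : Order.disp_t} {T : orderType d}.
Implicit Types (a b : T) (k : int).

(* An endpoint of the chain is the join (meet) of the empty set, so a least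
   element is a left limit and a greatest element is a right limit. *)
Definition left_limit a : Prop := supremums [set b | b < a] a.
Definition right_limit a : Prop := infimums [set b | a < b] a.

(* The copy (k, a) of a at level k is stored as the pair (a, k), so that the
   order is the library's lexicographic one; (a, 0) is the point a itself. *)
Definition intext_pred (x : T *l int) : bool :=
  [|| x.2 == 0%R,
      (0 < x.2)%R && `[< right_limit x.1 >] |
      (x.2 < 0)%R && `[< left_limit x.1 >]].

Record intext := Intext {
  intext_val : T *l int;
  intext_valP : intext_pred intext_val }.

HB.instance Definition _ := [isSub for intext_val].
HB.instance Definition _ := [Choice of intext by <:].
HB.instance Definition _ :=
  [SubChoice_isSubOrder of intext by <: with Order.lexi_display d ring_display].

End IntegralExtension.
Arguments intext {d} T.

Section Extension.
Context {d : Order.disp_t} {T : orderType d}.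

Definition pt (x : intext T) : T := (val x).1.
Definition lvl (x : intext T) : int := (val x).2.

Lemma intext_leE (x y : intext T) :
  (x <= y) = (pt x < pt y) || ((pt x == pt y) && (lvl x <= lvl y)%R).
Proof.
rewrite -Order.le_val /pt /lvl; case: (val x) (val y) => [a k] [b n].
by rewrite Order.ProdLexiOrder.leEprodlexi /=; case: ltgtP.
Qed.

(* A nonempty set has exactly one element iff it satisfies [is_subset1]; the
   fibers below contain [b]. *)
Definition single_fiber (f : resmap T) (b : T) : Prop :=
  is_subset1 (f @^-1` [set f b]).

Lemma single_fiber_right_limit (f : resmap T) b :
  single_fiber f b -> right_limit b -> right_limit (f b).
Proof.
move=> fib [_ blim]; split=> [c /ltW //|c cub].
rewrite -dres_funP; apply: blim => x /= bx; rewrite dres_funP.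
apply: cub => /=; rewrite lt_neqAle (resmap_homo _ (ltW bx)) andbT.
by apply: contraTN bx => /eqP fbx; rewrite (fib b x) ?ltxx.
Qed.

Lemma single_fiber_left_limit (f : resmap T) b :
  single_fiber f b -> left_limit b -> left_limit (f b).
Proof.
move=> fib [_ blim]; split=> [c /ltW //|c cub].
rewrite res_funP; apply: blim => x /= xb; rewrite -res_funP.
apply: cub => /=; rewrite lt_neqAle (resmap_homo _ (ltW xb)) andbT.
by apply: contraTN xb => /eqP fbx; rewrite (fib b x) ?ltxx.
Qed.

Definition ext_lvl (f : resmap T) (x : intext T) : int :=
  if `[< single_fiber f (pt x) >] then lvl x else 0%R.

Fact ext_fun_subproof (f : resmap T) (x : intext T) :
  intext_pred ((f (pt x), ext_lvl f x) : T *l int).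
Proof.
rewrite /intext_pred /ext_lvl /=; case: asboolP => //= fib.
have /or3P[->//|/andP[-> /asboolP lim]|/andP[-> /asboolP lim]] := valP x.
  by apply/or3P/Or32/asboolP; exact: single_fiber_right_limit.
by apply/or3P/Or33/asboolP; exact: single_fiber_left_limit.
Qed.

Definition ext_fun (f : resmap T) (x : intext T) : intext T :=
  Intext (ext_fun_subproof f x).

End Extension.

(* Main.v *)
(* A map with residuals and dual residuals of all orders preserves every
   existing join and meet, and so do its residuals.  Hence at a right limit
   [b] a fiber that contains no point above [b] contains no point below [b]
   either, and dually at a left limit.  So the singleton condition in the
   definition of the extension is one-sided, and in that form it is compatible
   with residuals, composition and joins.  Meets follow from joins because the
   residual turns meets into joins. *)
Require Import Defs.
From mathcomp Require Import all_boot all_order all_algebra.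
From mathcomp Require Import boolp.

Set Implicit Arguments.
Unset Strict Implicit.
Unset Printing Implicit Defensive.

Import Order.TTheory.
Local Open Scope order_scope.

(** * Limits and singleton fibers in the base chain *)

Section ResmapTheory.
Context {d : Order.disp_t} {T : orderType d}.
Implicit Types (f g : resmap T) (a b x y : T).

Lemma resmap_fun_inj : injective (@resmap_fun d T).
Proof. by move=> f g fg; apply: resmapP => x; rewrite fg. Qed.

Lemma radjP f : residual f (radj f).
Proof. exact: res_funP. Qed.

Lemma ladjP f : residual (ladj f) f.
Proof. exact: dres_funP. Qed.

Lemma le_radj f a b : (a <= radj f b) = (f a <= b).
Proof. by rewrite radjP. Qed.

Lemma ladj_le f a b : (ladj f a <= b) = (a <= f b).
Proof. exact: ladjP. Qed.

(** Taking residuals turns a meet into a join, and the dual residual recovers the map. *)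
Lemma resmap_meetE f g : f `&` g = ladj (radj f `|` radj g).
Proof.
apply: resmap_fun_inj.
exact: residual_uniql (residual_meet (radjP f) (radjP g))
  (ladjP (radj f `|` radj g)).
Qed.

(** Transposing the hypothesis makes [ladj f y] a lower bound of the points above [b], hence at most
    [b]. *)
Lemma le_right_limit f b y :
  right_limit b -> (forall x, b < x -> y <= f x) -> y <= f b.
Proof.
move=> [_ bub] yf; rewrite -ladj_le.
by apply: bub => x /= /yf; rewrite -ladj_le.
Qed.

Lemma left_limit_le f b y :
  left_limit b -> (forall x, x < b -> f x <= y) -> f b <= y.
Proof.
move=> [_ blub] fy; rewrite -le_radj.
by apply: blub => x /= /fy; rewrite -le_radj.
Qed.

(** As [f] is monotone, this excludes exactly the points above [b] from the fiber of [b];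
    inequalities transpose along residuals, equations do not. *)
Definition tight_above f b : Prop := forall x, f x <= f b -> x <= b.
Definition tight_below f b : Prop := forall x, f b <= f x -> b <= x.

Lemma single_fiberE f b :
  single_fiber f b <-> tight_above f b /\ tight_below f b.
Proof.
split=> [fib|[fa fb] x y /= fx fy].
  split=> x fx; case: leP => // bx; have fx' := resmap_homo f (ltW bx).
    by move: bx; rewrite (fib b x) ?ltxx //=; apply/le_anti; rewrite fx fx'.
  by move: bx; rewrite (fib b x) ?ltxx //=; apply/le_anti; rewrite fx fx'.
suff eqb z : f z = f b -> z = b by rewrite (eqb x fx) (eqb y fy).
by move=> fz; apply/le_anti; rewrite fa ?fb ?fz.
Qed.

(** By tightness [f] sends the points above [b] strictly above [f b], and the meet of these values
    is [f b]. *)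
Lemma tight_above_right_limit f b :
  right_limit b -> tight_above f b -> right_limit (f b).
Proof.
move=> blim fa; split=> [y /ltW //|y ylb].
apply: le_right_limit => // x bx; apply: ylb => /=.
by rewrite ltNge; apply: contraTN bx => /fa; rewrite leNgt.
Qed.

Lemma tight_below_left_limit f b :
  left_limit b -> tight_below f b -> left_limit (f b).
Proof.
move=> blim fb; split=> [y /ltW //|y yub].
apply: left_limit_le => // x xb; apply: yub => /=.
by rewrite ltNge; apply: contraTN xb => /fb; rewrite leNgt.
Qed.

(** Tightness makes [f b] a right limit, and each [y] above [f b] satisfies [b < ladj f y]. Since
    [ladj f] preserves this meet, [b <= ladj f (f b)], and [ladj f (f b) <= x] whenever
    [f b <= f x]. *)
Lemma single_fiber_above f b :
  right_limit b -> single_fiber f b <-> tight_above f b.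
Proof.
move=> blim; rewrite single_fiberE; split=> [[]//|fa]; split=> // x fbx.
rewrite -ladj_le in fbx; apply: le_trans fbx.
apply: le_right_limit; first exact: tight_above_right_limit.
by move=> y; rewrite ltNge -ladj_le -ltNge => /ltW.
Qed.

Lemma single_fiber_below f b :
  left_limit b -> single_fiber f b <-> tight_below f b.
Proof.
move=> blim; rewrite single_fiberE; split=> [[]//|fb]; split=> // x fbx.
rewrite -le_radj in fbx; apply: le_trans fbx _.
apply: left_limit_le; first exact: tight_below_left_limit.
by move=> y; rewrite ltNge -le_radj -ltNge => /ltW.
Qed.

(** The fiber of [f] at [g b] may contain points outside the range of [g]. At a limit the values of
    [g] near [b] approach [g b], which excludes such points. *)
Lemma single_fiber_comp f g b : left_limit b \/ right_limit b ->
  single_fiber (f * g)%g b <-> single_fiber g b /\ single_fiber f (g b).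
Proof.
move=> blim; split=> [|[gfib ffib] x y /= fx fy]; last first.
  by apply: gfib => /=; apply: ffib.
case: blim => blim.
- rewrite !(single_fiber_below _ blim) => fgb.
  have gb : tight_below g b by move=> x gx; exact/fgb/(resmap_homo f gx).
  split=> //; apply/single_fiber_below; first exact: tight_below_left_limit.
  move=> y fy; apply: left_limit_le => // x xb.
  case: leP => // /ltW/(resmap_homo f) fyx.
  by move: xb; rewrite ltNge fgb //=; exact: le_trans fyx.
- rewrite !(single_fiber_above _ blim) => fga.
  have ga : tight_above g b by move=> x gx; exact/fga/(resmap_homo f gx).
  split=> //; apply/single_fiber_above; first exact: tight_above_right_limit.
  move=> y fy; apply: le_right_limit => // x xb.
  case: leP => // /ltW/(resmap_homo f) fxy.
  by move: xb; rewrite ltNge fga //=; exact: le_trans fy.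
Qed.

(** The condition on ties is what comparing the two extensions at a positive level yields, where a
    collapsed level 0 is the smaller one. *)
Lemma tight_above_join f g b : right_limit b -> g b <= f b ->
    (g b = f b -> tight_above g b -> tight_above f b) ->
  tight_above (f `|` g) b <-> tight_above f b.
Proof.
move=> blim gfb gf; rewrite /tight_above.
have -> : (f `|` g) b = f b by exact: join_l.
split=> fga x; last by rewrite leUx => /andP[/fga].
move: gfb; rewrite le_eqVlt => /orP[/eqP gfb|gfb] fx.
  case: (pselect (tight_above g b)) => [/(gf gfb)|]; first exact.
  (* Here [g] does not exceed [g b] at some [z] above [b], so the join at the minimum of [x] and [z]
     is at most [f b]. That minimum is then at most [b], and it must be [x]. *)
  move=> /existsNP[z /not_implyP[gz /negP]]; rewrite -ltNge => bz.
  have : Order.min x z <= b.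
    apply: fga; rewrite leUx; apply/andP; split.
      by apply: le_trans fx; apply: resmap_homo; rewrite ge_min lexx.
    rewrite -gfb; apply: le_trans gz.
    by apply: resmap_homo; rewrite ge_min lexx orbT.
  by rewrite ge_min [z <= b]leNgt bz orbF.
(* If [x] were above [b], then [f b <= g z] for all [z] above [b], so the limit would give
   [f b <= g b]. *)
case: leP => // bx; move: gfb; rewrite ltNge.
rewrite (le_right_limit (f := g) blim) // => z bz.
apply: (@le_trans _ _ (g (Order.min x z))); last first.
  by apply: resmap_homo; rewrite ge_min lexx orbT.
case: leP => // /ltW gxz; suff : Order.min x z <= b.
  by rewrite ge_min !leNgt bx bz.
apply: fga; rewrite leUx gxz andbT; apply: le_trans fx.
by apply: resmap_homo; rewrite ge_min lexx.
Qed.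

(** At a negative level a collapse to 0 raises the copy, so the tie condition runs from [f] to [g].
    A tie is forced when [f b <= g x] with [x] below [b]. *)
Lemma tight_below_join f g b : g b <= f b ->
    (g b = f b -> tight_below f b -> tight_below g b) ->
  tight_below (f `|` g) b <-> tight_below f b.
Proof.
move=> gfb gf; rewrite /tight_below.
have -> : (f `|` g) b = f b by exact: join_l.
split=> fgb x; first by move=> fx; apply: fgb; rewrite lexU fx.
rewrite lexU => /orP[/fgb //|fgx].
case: leP => // xb; move: (xb); rewrite ltNge.
have gbfb : g b = f b.
  by apply/le_anti; rewrite gfb (le_trans fgx)// resmap_homo// ltW.
by rewrite (gf gbfb fgb) // gbfb.
Qed.

End ResmapTheory.

(** * Levels and residuals in the integral extension *)

Section ExtensionTheory.
Context {d : Order.disp_t} {T : orderType d}.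
Implicit Types (f g : resmap T) (x y : intext T).

Lemma intext_inj x y : pt x = pt y -> lvl x = lvl y -> x = y.
Proof.
move=> px lx; apply/val_inj; move: px lx; rewrite /pt /lvl.
by case: (val x) (val y) => [a k] [b n] /= -> ->.
Qed.

Lemma pt_ext f x : pt (ext_fun f x) = f (pt x).
Proof. by []. Qed.

Lemma lvl_ext f x : lvl (ext_fun f x) = ext_lvl f x.
Proof. by []. Qed.

Lemma lvl_gt0_right_limit x : (0 < lvl x)%R -> right_limit (pt x).
Proof.
case/or3P: (valP x) => [/eqP lx|/andP[_ /asboolP //]|/andP[lx _]] x0.
  by move: x0; rewrite /lvl lx ltxx.
by have := lt_trans x0 lx; rewrite ltxx.
Qed.

Lemma lvl_lt0_left_limit x : (lvl x < 0)%R -> left_limit (pt x).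
Proof.
case/or3P: (valP x) => [/eqP lx|/andP[lx _]|/andP[_ /asboolP //]] x0.
  by move: x0; rewrite /lvl lx ltxx.
by have := lt_trans x0 lx; rewrite ltxx.
Qed.

Lemma ext_lvl_single f x : single_fiber f (pt x) -> ext_lvl f x = lvl x.
Proof. by rewrite /ext_lvl => /asboolT ->. Qed.

Lemma ext_lvl_le0 f x : (lvl x <= 0)%R -> (ext_lvl f x <= 0)%R.
Proof. by rewrite /ext_lvl; case: ifP. Qed.

Lemma ext_lvl_ge0 f x : (0 <= lvl x)%R -> (0 <= ext_lvl f x)%R.
Proof. by rewrite /ext_lvl; case: ifP. Qed.

(** Levels matter only at ties between points. A tie on one side alone collapses the level of the
    image there to 0, and preservation of limits fixes the sign of the other level. *)
Lemma ext_residual f g : residual f g -> residual (ext_fun f) (ext_fun g).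
Proof.
move=> fg x y; rewrite !intext_leE !pt_ext !lvl_ext.
case: (ltgtP (f (pt x)) (pt y)) => [fxy|yfx|fxy] /=.
- have := ltW fxy; rewrite fg; case: ltgtP => //= xy _; apply/esym.
  (* [f (pt x)] is a second point in the fiber of [g] at [pt y]. *)
  rewrite /ext_lvl asboolF; last first.
    move=> /single_fiberE[_ /(_ (f (pt x)))].
    by rewrite -xy -fg lexx [pt y <= _]leNgt fxy => /(_ isT).
  rewrite leNgt; apply/negP => /lvl_gt0_right_limit xlim.
  move: fxy; rewrite ltNge (le_right_limit (f := f) xlim) // => z.
  by rewrite xy ltNge -fg -ltNge => /ltW.
- have : g (pt y) < pt x by rewrite ltNge -fg -ltNge.
  by case: ltgtP.
have : f (pt x) <= pt y by rewrite fxy.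
rewrite fg; case: ltgtP => //= xy _.
  rewrite /ext_lvl asboolF; last first.
    move=> /single_fiberE[/(_ (g (pt y)))].
    by rewrite fxy fg lexx leNgt xy => /(_ isT).
  rewrite leNgt; apply/negP => /lvl_lt0_left_limit ylim.
  move: xy; rewrite ltNge (left_limit_le (f := g) ylim) // => z.
  by rewrite -fxy ltNge fg -ltNge => /ltW.
(* With ties on both sides the adjunction gives one half of each singleton condition. If [lvl x] is
   positive or [lvl y] negative, the limit gives the other halves and no level collapses. *)
have fa : tight_above f (pt x) by move=> z; rewrite fxy fg -xy.
have rb : tight_below g (pt y).
  by move=> z; rewrite -xy -fg fxy.
have [x0|x0] := ltP 0%R (lvl x).
  have xlim := lvl_gt0_right_limit x0.
  rewrite !ext_lvl_single //; last exact/single_fiber_above.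
  apply/single_fiberE; split=> // z; rewrite -xy -fxy => rz.
  apply: le_right_limit => // w xw; case: leP => // /ltW; rewrite fg.
  by move=> /le_trans/(_ rz); rewrite leNgt xw.
have [y0|y0] := ltP (lvl y) 0%R.
  have ylim := lvl_lt0_left_limit y0.
  rewrite !ext_lvl_single //; first exact/single_fiber_below.
  apply/single_fiberE; split=> // z; rewrite fxy xy => fz.
  apply: left_limit_le => // w wy; case: leP => // /ltW; rewrite -fg.
  by move=> /(le_trans fz); rewrite leNgt wy.
(* Now [lvl x <= 0 <= lvl y], so both comparisons hold. *)
by rewrite (le_trans (ext_lvl_le0 _ x0) y0) (le_trans x0) // ext_lvl_ge0.
Qed.

Fact ext_homo f : {homo ext_fun f : x y / x <= y}.
Proof. exact: residual_homo (ext_residual (radjP f)). Qed.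

Fact ext_res f n : has_residuals n (ext_fun f).
Proof.
elim: n f => //= n IHn f.
by exists (ext_fun (radj f)); [exact: ext_residual (radjP f)|exact: IHn].
Qed.

Fact ext_dres f n : has_dual_residuals n (ext_fun f).
Proof.
elim: n f => //= n IHn f.
by exists (ext_fun (ladj f)); [exact: ext_residual (ladjP f)|exact: IHn].
Qed.

(** * The embedding and the operations it preserves *)

Definition ext f : resmap (intext T) :=
  Resmap (@ext_homo f) (ext_res f) (ext_dres f).

Lemma ext_inj : injective ext.
Proof.
move=> f g fg; apply: resmapP => a.
have a0 : intext_pred ((a, 0%R) : T *l int) by [].
by have := congr1 (fun h : resmap (intext T) => pt (h (Intext a0))) fg.
Qed.

Lemma ext1 : ext 1%g = 1%g.
Proof.
apply: resmapP => x; apply: intext_inj => //.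
by rewrite lvl_ext ext_lvl_single // => y z /= -> ->.
Qed.

Lemma ext_mul : {morph ext : f g / (f * g)%g}.
Proof.
move=> f g; apply: resmapP => x; apply: intext_inj => //.
rewrite !lvl_ext /ext_lvl pt_ext lvl_ext /ext_lvl.
(* Level 0 stays 0 under every extension; any other level sits over a limit point. *)
have [->|x0] := eqVneq (lvl x) 0%R; first by rewrite !if_same.
have -> : `[< single_fiber (f * g)%g (pt x) >] =
    `[< single_fiber f (g (pt x)) >] && `[< single_fiber g (pt x) >].
  rewrite andbC -asbool_and; apply: asbool_equiv_eq; apply: single_fiber_comp.
  case: (ltgtP (lvl x) 0%R) x0 => // x0 _.
    by left; exact: lvl_lt0_left_limit.
  by right; exact: lvl_gt0_right_limit.
by case: asboolP.
Qed.

Lemma ext_radj : {morph ext : f / radj f}.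
Proof.
move=> f; apply: resmap_fun_inj.
exact: residual_uniqr (ext_residual (radjP f)) (radjP (ext f)).
Qed.

Lemma ext_ladj : {morph ext : f / ladj f}.
Proof.
move=> f; apply: resmap_fun_inj.
exact: residual_uniql (ext_residual (ladjP f)) (ladjP (ext f)).
Qed.

(** The extension is a chain, so preservation of joins reduces to this case by symmetry. *)
Lemma ext_join_le f g x :
  ext g x <= ext f x -> ext (f `|` g) x = ext f x.
Proof.
rewrite intext_leE !pt_ext !lvl_ext => gf.
have gfx : g (pt x) <= f (pt x) by case: ltgtP gf.
have {}gf : g (pt x) = f (pt x) -> (ext_lvl g x <= ext_lvl f x)%R.
  by move: gf => /[swap] ->; rewrite ltxx eqxx.
apply: intext_inj; first exact: join_l.
rewrite !lvl_ext; move: gf; rewrite /ext_lvl.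
have [x0|x0|->] := ltgtP (lvl x) 0%R; last by rewrite !if_same.
- have xlim := lvl_lt0_left_limit x0.
  rewrite !(asbool_equiv_eq (single_fiber_below _ xlim)) => gf.
  rewrite (asbool_equiv_eq (tight_below_join gfx _)) // => /gf {gf}.
  (* If [f] kept the negative level while [g] collapsed it, the hypothesis would read
     [0 <= lvl x]. *)
  by case: asboolP => // _; case: asboolP => // _; rewrite leNgt x0.
- have xlim := lvl_gt0_right_limit x0.
  rewrite !(asbool_equiv_eq (single_fiber_above _ xlim)) => gf.
  rewrite (asbool_equiv_eq (tight_above_join xlim gfx _)) // => /gf {gf}.
  by case: asboolP => // _; case: asboolP => // _; rewrite leNgt x0.
Qed.

Lemma ext_join : {morph ext : f g / f `|` g}.
Proof.
move=> f g; apply: resmapP => x.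
have -> : (ext f `|` ext g) x = ext f x `|` ext g x by [].
have [fg|/ltW gf] := leP (ext f x) (ext g x).
  by rewrite joinC ext_join_le // (join_r fg).
by rewrite ext_join_le // (join_l gf).
Qed.

Lemma ext_meet : {morph ext : f g / f `&` g}.
Proof.
by move=> f g; rewrite !resmap_meetE ext_ladj ext_join !ext_radj.
Qed.

End ExtensionTheory.

Theorem theorem2p10 (d : Order.disp_t) (T : orderType d) :
  exists phi : resmap T -> resmap (intext T),
    (forall (f : resmap T) (x : intext T), phi f x = ext_fun f x) /\
    lpregroup_embedding phi.
Proof.
exists ext; split=> //; split; first exact: ext_inj.
split; [|exact: ext_meet|exact: ext_join|exact: ext_ladj|exact: ext_radj].
by split; [exact: ext1|exact: ext_mul].
Qed.
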